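(* There exists an absolute constant $C>0$ such that the following holds. Let $d$ be a positive integer and let $\chi$ be an irreducible character of $S_n$ of level $d$. Set $\gamma=\left(\frac{Cd}{n}\right)^{d}\chi(1)$. Then $\chi$ is $(2,\gamma)$-global.
   Context: $S_n$ is the symmetric group on $n$ letters, and irreducible characters are the complex irreducible characters $\chi_\lambda$ indexed by partitions $\lambda=(\lambda_1\ge\lambda_2\ge\cdots)$ of $n$. Write $\lambda'$ for the conjugate partition (transposed Young diagram), so $\lambda_1'$ is the number of parts of $\lambda$. The level of $\chi_\lambda$ is $\min(n-\lambda_1,\,n-\lambda_1')$. For $m\le n$ and $m$-tuples $I,J$ of elements of $\{1,\dots,n\}$, each having distinct coordinates, $U_{I\to J}\subseteq S_n$ is the set of permutations sending the elements of $I$ to the elements of $J$ in the same order (i.e. $\sigma(I_k)=J_k$ for all $k$). For $f\colon S_n\to\mathbb{R}$, $f_{I\to J}$ is the restriction of $f$ to $U_{I\to J}$, and $$\|f_{I\to J}\|_2^2=\frac{1}{(n-m)!}\sum_{\sigma\in U_{I\to J}}f(\sigma)^2.$$ The function $f$ is $(r,\gamma)$-global if for all $m$ and all pairs $I,J$ of $m$-tuples of distinct coordinates, $\|f_{I\to J}\|_2\le r^{m}\gamma$. *)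

(* Defs.v *)
From mathcomp Require Import all_boot all_order all_algebra.
From mathcomp Require Import all_fingroup all_solvable all_field all_character.
Set Implicit Arguments.
Unset Strict Implicit.
Unset Printing Implicit Defensive.
Import Order.TTheory GRing.Theory Num.Theory.
Local Open Scope ring_scope.

Definition is_partition (n : nat) (lam : seq nat) : bool :=
  [&& sorted geq lam, 0%N \notin lam & sumn lam == n].

Definition conj_part (lam : seq nat) : seq nat :=
  mkseq (fun j => count (fun a => (j < a)%N) lam) (head 0%N lam).

Definition part_level (n : nat) (lam : seq nat) : nat :=
  minn (n - head 0%N lam) (n - head 0%N (conj_part lam)).

(* The Young diagram of lam is filled with 0, ..., n-1 row after row: the letter
   k lies in row [reshape_index lam k] and in column [reshape_offset lam k]. *)
Definition row_group (n : nat) (lam : seq nat) : {set 'S_n} :=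
  [set s : 'S_n | [forall k, reshape_index lam (s k) == reshape_index lam k]].

Definition col_group (n : nat) (lam : seq nat) : {set 'S_n} :=
  [set s : 'S_n | [forall k, reshape_offset lam (s k) == reshape_offset lam k]].

(* The Young symmetrizer \sum_(p, q) sgn(q) p q in the group algebra of S_n,
   whose elements are the row vectors on which the regular representation acts
   by right multiplication. *)
Definition young_sym (n : nat) (lam : seq nat) : 'rV[algC]_#|[set: 'S_n]| :=
  \sum_(p in row_group n lam) \sum_(q in col_group n lam)
     (-1) ^+ odd_perm q *: delta_mx 0 (gring_index [set: 'S_n] (p * q)%g).

(* chi_lam is the character of the ideal of the group algebra generated by the
   Young symmetrizer of lam, i.e., of the Specht module of lam. *)
Definition specht_char (n : nat) (lam : seq nat) : 'CF([set: 'S_n]) :=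
  cfRepr (submod_repr
    (cyclic_mx_module (regular_repr algC [set: 'S_n]) (young_sym n lam))).

Definition has_level (n : nat) (chi : 'CF([set: 'S_n])) (d : nat) : Prop :=
  exists lam : seq nat,
    [/\ is_partition n lam, chi = specht_char n lam & part_level n lam = d].

Definition umvirate (n m : nat) (I J : m.-tuple 'I_n) : {set 'S_n} :=
  [set s : 'S_n | [forall k, s (tnth I k) == tnth J k]].

Definition norm2_restr (n m : nat) (f : 'S_n -> algC) (I J : m.-tuple 'I_n) :
    algC :=
  sqrtC (((n - m)`!)%:R^-1 * \sum_(s in umvirate I J) f s ^+ 2).

(* Real-valued functions on S_n are represented as functions to algC with real
   values, so that characters are among them; uniq I forces m <= n. *)
Definition is_global (n : nat) (r gamma : algC) (f : 'S_n -> algC) : Prop :=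
  (forall s, f s \is Num.real) /\
  forall (m : nat) (I J : m.-tuple 'I_n), uniq I -> uniq J ->
    norm2_restr f I J <= r ^+ m * gamma.

(* Main.v *)
Require Import Defs.
From mathcomp Require Import all_boot all_order all_algebra.
From mathcomp Require Import all_fingroup all_solvable all_field all_character.
From mathcomp Require Import ring zify.
Set Implicit Arguments.
Unset Strict Implicit.
Unset Printing Implicit Defensive.
Import Order.TTheory GRing.Theory Num.Theory.
Local Open Scope ring_scope.

(** The constant is C = 4. Let chi have level d, let I be a tuple of m points
with pointwise stabiliser H, and note that the permutations carrying I to J
form a coset of H. If n < 2d then 4d/n > 1 and |chi| <= chi(1) is enough, so
assume 2d <= n.

The proof rests on one auxiliary character: let D be a set of d letters, Y its
setwise stabiliser, and psi a character of Y that is not orthogonal to the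
restriction of chi. Then chi is a constituent of theta = Ind psi. Two facts
give an upper bound in terms of psi(1) alone ([coset_norm2_le_constt]).
 - The sum of |chi|^2 over a coset of H is at most the sum of |theta|^2 over H
   itself ([coset_norm2_le]): |chi|^2 is a character, characters are positive
   definite, and adding a character to chi only increases its norm over H.
 - The induction formula gives |theta(s)| <= psi(1) pi(s), where pi(s) counts
   the d-sets fixed by s. By Burnside, the mean of pi^2 over H is the number of
   H-orbits on pairs (B, B') of d-sets. Up to H such a pair is determined by
   its traces on I and by the size of its intersection, so there are at most
   4^m (d + 1) orbits ([sum_fixed_sets_sqr]). This is where the factor 2^m of
   the theorem comes from; d + 1 <= 4^d goes into the constant.

It remains to find psi with binom(n - d, d) psi(1) <= chi(1), because
binom(n - d, d) >= (n / 2d)^d ([level_bin_bound]). Let D be the set of letters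
outside the first row, or outside the first column if that one is longer. The
Specht module is the row space of the matrix T of left multiplication by the
Young symmetrizer c. The part of c supported on Y ([block_part]) generates a Y-module L.
At most d letters of the first row share a column with D. For each d-set B that
avoids these letters, some elements of the Specht module restrict, on the
permutations that send D into any such set, to copies of L living exactly over
B; copies over distinct sets have disjoint supports, hence
binom(n - d, d) dim L <= chi(1) ([rank_block_module]). Finally T and its
transpose commute with right translations, so they map L to Y-submodules of no
larger dimension, and a positivity argument shows that the images of L under
T^T and under T^T T do not vanish. The first image lies in the row space of
T^T and the second in that of T ([small_block_submodule]). Transposing T
exchanges the roles of rows and columns, so one argument serves a long first
row and a long first column alike. *)

(** * Sums of characters over cosets *)

Section CosetSums.
Variables (gT : finGroupType) (G H : {group gT}).
Hypothesis sHG : H \subset G.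

(** The generalised orthogonality relation writes chi(y^-1 x) as a Gram matrix;
averaging it over H on both sides expresses a coset sum as an inner product of
two translates of u. *)
Lemma irr_coset_sum_gram (i : Iirr G) t : t \in G ->
  let u x := \sum_(h in H) 'chi_i (x * h)%g in
  \sum_(h in H) 'chi_i (h * t)%g =
    'chi_i 1%g / (#|G|%:R * #|H|%:R) * \sum_(x in G) u (t * x)%g * (u x)^*.
Proof.
move=> Gt u.
have nzG : #|G|%:R != 0 :> algC by rewrite pnatr_eq0 -lt0n cardG_gt0.
have nzH : #|H|%:R != 0 :> algC by rewrite pnatr_eq0 -lt0n cardG_gt0.
have orth y : \sum_(x in G) 'chi_i (x * y)%g * 'chi_i x^-1%g
    = #|G|%:R * ('chi_i y / 'chi_i 1%g).
  have := generalized_orthogonality_relation y i i.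
  by rewrite eqxx mul1r => <-; rewrite mulVKf.
have -> : \sum_(x in G) u (t * x)%g * (u x)^* =
    \sum_(k in H) \sum_(h in H) #|G|%:R * ('chi_i (h * t)%g / 'chi_i 1%g).
  transitivity (\sum_(k in H) \sum_(h in H)
      \sum_(x in G) 'chi_i (t * x * h)%g * ('chi_i (x * k)%g)^*).
    rewrite [RHS](eq_bigr (fun k => \sum_(x in G) \sum_(h in H)
       'chi_i (t * x * h)%g * ('chi_i (x * k)%g)^*)); last first.
      by move=> k _; rewrite exchange_big.
    rewrite [RHS]exchange_big; apply: eq_bigr => x _ /=.
    rewrite /u rmorph_sum mulr_sumr; apply: eq_bigr => k _.
    by rewrite mulr_suml.
  apply: eq_bigr => k Hk.
  have Gk := subsetP sHG k Hk.
  (* the substitutions h := k h and x := x k^-1 make k disappear *)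
  rewrite (reindex_inj (mulgI k)) /=; rewrite (eq_bigl (mem H)); last first.
    by move=> h; rewrite groupMl.
  apply: eq_bigr => h Hh; rewrite -orth.
  have Gh := subsetP sHG h Hh.
  rewrite (reindex_inj (mulIg k^-1%g)) /=; rewrite (eq_bigl (mem G)); last first.
    by move=> x; rewrite groupMr ?groupV.
  apply: eq_bigr => x Gx.
  rewrite mulgKV char_inv ?irr_char // -!mulgA mulKg; congr (_ * _).
  by rewrite -(cfunJ 'chi_i (t * (x * h))%g Gt) conjgE !mulgA mulVg mul1g.
rewrite sumr_const -mulr_natr -mulr_sumr -mulr_suml.
have nzc := irr1_neq0 i.
set S := \sum_(_ in H) _; set c := 'chi_i 1%g in nzc *.
by field; rewrite nzG nzH nzc.
Qed.

(** Both sides are inner products of translates of the same function u, so this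
is the inequality 2ab <= a^2 + b^2 summed over the group. *)
Lemma irr_coset_sum_le (i : Iirr G) t : t \in G ->
  `|\sum_(h in H) 'chi_i (h * t)%g| <= \sum_(h in H) 'chi_i h.
Proof.
move=> Gt; rewrite (irr_coset_sum_gram i Gt).
have -> : \sum_(h in H) 'chi_i h = \sum_(h in H) 'chi_i (h * 1)%g.
  by apply: eq_bigr => h; rewrite mulg1.
rewrite (irr_coset_sum_gram i (group1 G)).
set u := fun x => \sum_(h in H) 'chi_i (x * h)%g; set k := _ / _.
have k_ge0 : 0 <= k.
  by rewrite divr_ge0 ?mulr_ge0 ?ler0n // ltW // irr1_gt0.
rewrite normrM (ger0_norm k_ge0); apply: ler_wpM2l => //.
apply: le_trans (ler_norm_sum _ _ _) _.
have shift : \sum_(x in G) `|u (t * x)%g| ^+ 2 = \sum_(x in G) `|u x| ^+ 2.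
  rewrite [RHS](reindex_inj (mulgI t)) /=; apply: eq_bigl => x.
  by rewrite groupMl.
apply: (@le_trans _ _ (\sum_(x in G) (`|u (t * x)%g| ^+ 2 + `|u x| ^+ 2) / 2)).
  apply: ler_sum => x _; rewrite normrM norm_conjC.
  rewrite ler_pdivlMr ?ltr0n // mulr_natr.
  have -> : forall a b : algC, (a * b *+ 2 <= a ^+ 2 + b ^+ 2)
      = (0 <= (a - b) ^+ 2).
    by move=> a b; rewrite -subr_ge0; congr (_ <= _); ring.
  by rewrite real_exprn_even_ge0 // rpredB ?normr_real.
rewrite -mulr_suml big_split /= shift -mulr2n -[X in X / _]mulr_natr mulfK ?pnatr_eq0 //.
by under [leRHS]eq_bigr => x _ do rewrite mul1g -normCK.
Qed.

Lemma char_coset_sum_le (psi : 'CF(G)) t : psi \is a character -> t \in G ->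
  `|\sum_(h in H) psi (h * t)%g| <= \sum_(h in H) psi h.
Proof.
move=> Npsi Gt; rewrite [psi]cfun_sum_cfdot.
have expand (f : gT -> gT) :
    \sum_(h in H) (\sum_i '[psi, 'chi_i] *: 'chi_i) (f h)
      = \sum_i '[psi, 'chi_i] * \sum_(h in H) 'chi_i (f h).
  rewrite (eq_bigr (fun h => \sum_i '[psi, 'chi_i] * 'chi_i (f h))).
    by rewrite exchange_big; apply: eq_bigr => i _; rewrite mulr_sumr.
  by move=> h _; rewrite sum_cfunE; apply: eq_bigr => i _; rewrite cfunE.
rewrite (expand (fun h => h * t)%g) (expand id).
apply: le_trans (ler_norm_sum _ _ _) _; apply: ler_sum => i _.
have c_ge0 : 0 <= '[psi, 'chi_i] by apply/natr_ge0/Cnat_cfdot_char_irr.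
by rewrite normrM (ger0_norm c_ge0) ler_wpM2l // irr_coset_sum_le.
Qed.

(** The first inequality is positive definiteness of the character |chi|^2; the
second holds because inner products of characters are nonnegative. *)
Lemma coset_norm2_le (chi theta : 'CF(G)) t :
    chi \is a character -> theta - chi \is a character -> t \in G ->
  \sum_(h in H) `|chi (h * t)%g| ^+ 2 <= \sum_(h in H) `|theta h| ^+ 2.
Proof.
move=> Nchi Neta Gt.
have le1 : \sum_(h in H) `|chi (h * t)%g| ^+ 2 <= \sum_(h in H) `|chi h| ^+ 2.
  have Npsi : chi * chi^*%CF \is a character.
    by rewrite rpredM ?cfConjC_char.
  have psiE x : (chi * chi^*%CF) x = `|chi x| ^+ 2 by rewrite !cfunE normCK.
  have := char_coset_sum_le Npsi Gt.
  rewrite (eq_bigr _ (fun h _ => psiE (h * t)%g)) (eq_bigr _ (fun h _ => psiE h)).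
  by rewrite ger0_norm // sumr_ge0 // => h _; rewrite exprn_ge0.
apply: le_trans le1 _.
have nH : (0 : algC) < #|H|%:R by rewrite ltr0n cardG_gt0.
have cfn (phi : 'CF(G)) : \sum_(h in H) `|phi h| ^+ 2 = #|H|%:R * '['Res[H] phi].
  rewrite (cfnormE (cfun_onG _)) mulVKf ?gt_eqF //.
  by apply: eq_bigr => h Hh; rewrite cfResE.
rewrite !cfn; apply: ler_wpM2l; first exact: ltW.
have -> : theta = chi + (theta - chi) by rewrite addrC subrK.
rewrite raddfD cfnormD /= -addrA. rewrite lerDl.
have N0 : 0 <= '['Res[H] chi, 'Res[H] (theta - chi)].
  by apply/natr_ge0/Cnat_cfdot_char; apply: cfRes_char.
by rewrite addr_ge0 ?cfnorm_ge0 ?addr_ge0 ?conjC_ge0.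
Qed.
End CosetSums.

(** * Counting sets fixed by permutations *)

Lemma perm_of_fibers (T : eqType) n (f g : 'I_n -> T) :
    (forall t, #|[set x | f x == t]| = #|[set x | g x == t]|) ->
  exists s : 'S_n, forall x, g (s x) = f x.
Proof.
move=> eq_card.
have /tuple_permP[s Es] : perm_eq [tuple f i | i < n] [tuple g i | i < n].
  apply/allP => t _ /=.
  rewrite !count_map; apply/eqP; move: (eq_card t).
  by rewrite !cardsE !cardE /enum_mem !size_filter.
exists s => x; have := congr1 (fun u => nth (f x) u x) Es.
have nf (h : 'I_n -> T) : nth (f x) [tuple h i | i < n] x = h x.
  by rewrite -tnth_nth tnth_mktuple.
by rewrite !nf tnth_mktuple.
Qed.

(** Label every point by itself if it lies in I, and by its membership in B and
in B' otherwise: the hypotheses say that the two labellings have fibers of the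
same sizes. *)
Lemma perm_on_of_cards n (I B B' C C' : {set 'I_n}) :
    B :&: I = C :&: I -> B' :&: I = C' :&: I ->
    #|B| = #|C| -> #|B'| = #|C'| -> #|B :&: B'| = #|C :&: C'| ->
  exists2 s : 'S_n, perm_on (~: I) s & s @: B = C /\ s @: B' = C'.
Proof.
move=> eI eI' eB eB' eBB'.
have inI x : x \in I -> (x \in B) = (x \in C).
  by move=> Ix; have := congr1 (fun A : {set _} => x \in A) eI; rewrite !inE Ix !andbT.
have inI' x : x \in I -> (x \in B') = (x \in C').
  by move=> Ix; have := congr1 (fun A : {set _} => x \in A) eI'; rewrite !inE Ix !andbT.
pose lab (X X' : {set 'I_n}) x := (if x \in I then Some x else None, (x \in X, x \in X')).
have [|s Es] := @perm_of_fibers _ n (lab B B') (lab C C').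
  move=> [[y|] [b b']].
    congr #|pred_of_set _|; apply/setP => x; rewrite !inE /lab.
    by case: ifP => // Ix; rewrite (inI x Ix) (inI' x Ix).
  have cardsCI (X : {set 'I_n}) : #|X :\: I| = (#|X| - #|X :&: I|)%N by rewrite cardsD.
  have eD : #|B :\: I| = #|C :\: I| by rewrite !cardsCI eI eB.
  have eD' : #|B' :\: I| = #|C' :\: I| by rewrite !cardsCI eI' eB'.
  have eDD' : #|(B :&: B') :\: I| = #|(C :&: C') :\: I|.
    by rewrite !cardsCI eBB' setIIl eI eI' -setIIl.
  have split1 (X X' : {set 'I_n}) : #|X :\: I| = (#|X :&: X' :\: I| + #|X :\: X' :\: I|)%N.
    rewrite -(cardsID X' (X :\: I)); congr addn; congr #|pred_of_set _|.
      by rewrite setIDAC.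
    by rewrite setDDl setUC -setDDl.
  have cardF (X X' : {set 'I_n}) : [set x | lab X X' x == (None, (b, b'))] =
      (if b then if b' then (X :&: X') :\: I else X :\: X' :\: I
       else if b' then X' :\: X :\: I else ~: (X :|: X') :\: I).
    apply/setP => x; rewrite inE /lab !xpair_eqE.
    case Ix: (x \in I); case: b; case: b'; rewrite !inE ?Ix ?andbF //=;
      by do 2!case: (x \in _).
  rewrite !cardF; case: b {cardF}; case: b' => //.
  - by apply/eqP; rewrite -(eqn_add2l #|B :&: B' :\: I|) -split1 eDD' -split1 eD.
  - rewrite -[X in X = _]addn0 -[X in _ = X]addn0.
    apply/eqP; rewrite !addn0 -(eqn_add2l #|B' :&: B :\: I|) -split1 setIC eDD' setIC.
    by rewrite -split1 eD'.
  have comp (X X' : {set 'I_n}) : (#|~: (X :|: X') :\: I| +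
      (#|X :\: I| + #|X' :\: I|) = #|~: I| + #|(X :&: X') :\: I|)%N.
    rewrite -cardsUI -setDUl -setDIl addnA; congr addn.
    rewrite -cardsUI -setDUl -setDIl [_ :|: (X :|: X')]setUC setUCr setIC setICr.
    by rewrite set0D cards0 addn0 setTD.
  have := comp B B'; rewrite eD eD' eDD' -comp => /eqP.
  by rewrite eqn_add2r => /eqP.
have sI x : (s x \in I) = (x \in I) /\ (x \in I -> s x = x).
  have := congr1 fst (Es x); rewrite /lab /=; case: ifP; case: ifP => // _ _.
  by case=> ->.
exists s; first by apply/subsetP => x; rewrite !inE; apply: contraNN => /(proj2 (sI x)) /eqP.
split; apply/setP => y; rewrite -[y](permKV s) mem_imset ?inE; try exact: perm_inj.
  by have [] := Es (s^-1 y)%g.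
by have [] := Es (s^-1 y)%g.
Qed.
Definition pair_act n (z : {set 'I_n} * {set 'I_n}) (s : 'S_n) :=
  (s @: z.1, s @: z.2).

Lemma pair_act1 n : (@pair_act n)^~ 1%g =1 id.
Proof.
move=> [B B']; rewrite /pair_act /=.
by congr pair; rewrite -[RHS]imset_id; apply: eq_imset => x; rewrite perm1.
Qed.

Lemma pair_actM n z : act_morph (@pair_act n) z.
Proof.
move=> s t; rewrite /pair_act /=.
by congr pair; rewrite -imset_comp; apply: eq_imset => x; rewrite permM.
Qed.

Definition pair_action n : {action 'S_n &-> {set 'I_n} * {set 'I_n}} :=
  TotalAction (@pair_act1 n) (@pair_actM n).

Definition fixed_sets n d (s : 'S_n) : {set {set 'I_n}} :=
  [set B : {set 'I_n} | (#|B| == d) && (s @: B == B)].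

(** Burnside's lemma for the action on pairs of d-sets. The two traces on I
contribute 2^m each and the size of the intersection d + 1. *)
Lemma sum_fixed_sets_sqr n d (I : {set 'I_n}) :
  (\sum_(s in 'C(I | 'P)%g) #|fixed_sets d s| ^ 2 <=
     4 ^ #|I| * d.+1 * #|'C(I | 'P)%g|)%N.
Proof.
set H := 'C(I | 'P)%G.
pose S := [set z : {set 'I_n} * {set 'I_n} | (#|z.1| == d) && (#|z.2| == d)].
have actS : [acts H, on S | pair_action n].
  apply/actsP => s _ [B B'] /=; rewrite !inE /=.
  by rewrite !card_imset //; apply: perm_inj.
have fixE s : #|'Fix_(S | pair_action n)[s]%g| = (#|fixed_sets d s| ^ 2)%N.
  rewrite -mulnn -cardsX; congr #|pred_of_set _|; apply/setP => -[B B'].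
  apply/setIP/setXP => [[] | []]; rewrite !inE /=.
    by move=> /andP[-> ->]; rewrite sub1set inE => /eqP[-> ->]; rewrite !eqxx.
  move=> /andP[-> /eqP eB] /andP[-> /eqP eB'].
  by split=> //; rewrite sub1set inE /= /pair_act /= eB eB'.
rewrite (eq_bigr (fun s => #|'Fix_(S | pair_action n)[s]%g|)) => [|s _]; last first.
  by rewrite fixE.
rewrite (Frobenius_Cauchy actS) leq_mul2r; apply/orP; right.
pose inv (z : {set 'I_n} * {set 'I_n}) :=
  ((z.1 :&: I, z.2 :&: I), inord #|z.1 :&: z.2| : 'I_d.+1).
have inv_orbit z w : z \in S -> w \in S -> inv z = inv w ->
    orbit (pair_action n) H z = orbit (pair_action n) H w.
  case: z w => [B B'] [C C']; rewrite !inE /= => /andP[/eqP cB /eqP cB'].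
  move=> /andP[/eqP cC /eqP cC'] [eI eI' eBB'].
  have small (X X' : {set 'I_n}) : #|X| = d -> (#|X :&: X'| < d.+1)%N.
    by move=> <-; rewrite ltnS subset_leq_card ?subsetIl.
  have {}eBB' : #|B :&: B'| = #|C :&: C'|.
    by rewrite -(inordK (small _ B' cB)) eBB' inordK ?small.
  have [||s ons [sB sB']] := perm_on_of_cards eI eI' _ _ eBB'.
  - by rewrite cB cC.
  - by rewrite cB' cC'.
  apply/esym/(orbit_in_eqP (subsetT _))/imsetP; exists s; last first.
    by rewrite /= /pair_act /= sB sB'.
  by apply/astabP => x Ix /=; rewrite /aperm (out_perm ons) ?inE ?Ix.
have [->|[z0 Sz0]] := set_0Vmem S; first by rewrite imset0 cards0.
(* any section of inv on S indexes the orbits by the values of inv *)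
pose back v := odflt z0 [pick z in S | inv z == v].
have -> : [set orbit (pair_action n) H z | z in S] =
    [set orbit (pair_action n) H (back v) | v in inv @: S].
  rewrite -[RHS]imset_comp; apply: eq_in_imset => z Sz /=.
  rewrite /back; case: pickP => [w /andP[Sw /eqP e]|/(_ z)]; last by rewrite Sz eqxx.
  exact: inv_orbit.
apply: leq_trans (leq_imset_card _ _) _.
have sub : inv @: S \subset setX (setX (powerset I) (powerset I)) setT.
  apply/subsetP => _ /imsetP[z _ ->]; rewrite !inE /= !andbT.
  by rewrite !subsetIr.
apply: leq_trans (subset_leq_card sub) _.
by rewrite !cardsX card_powerset cardsT card_ord -expnMn.
Qed.

(** * Characters induced from the stabiliser of a set *)

(** A conjugate x ^ y stabilises D exactly when x fixes the image of D under
y^-1, and each set is such an image for at most #|Y| elements y. *)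
Lemma cfInd_norm_le n (D : {set 'I_n}) (psi : 'CF('N(D | 'P)%G)) x :
    psi \is a character ->
  `|'Ind[[set: 'S_n]%G] psi x| <= psi 1%g * #|fixed_sets #|D| x|%:R.
Proof.
move=> Npsi; set Y := 'N(D | 'P)%G.
have YE s : (s \in Y) = (s @: D == D).
  rewrite eqEcard card_imset ?leqnn ?andbT; last exact: perm_inj.
  apply/astabsP/subsetP => [sD _ /imsetP[a Da ->]|sD a]; first by rewrite -[s a]/(aperm a s) sD.
  apply/idP/idP => [|Da]; last by apply: sD; apply: imset_f.
  have /eqP eD : s @: D == D.
    by rewrite eqEcard card_imset ?leqnn ?andbT; [apply/subsetP | exact: perm_inj].
  by move=> /=; rewrite -{1}eD /aperm mem_imset //; apply: perm_inj.
have nY : (0 : algC) < #|Y|%:R by rewrite ltr0n cardG_gt0.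
rewrite cfIndE ?subsetT // normrM ger0_norm ?invr_ge0 ?ler0n //.
rewrite ler_pdivrMl //.
apply: le_trans (ler_norm_sum _ _ _) _.
pose tr (y : 'S_n) := y^-1%g @: D.
have conjY y : ((x ^ y)%g \in Y) = (tr y \in fixed_sets #|D| x).
  rewrite YE inE card_imset ?eqxx /=; last exact: perm_inj.
  rewrite -(inj_eq (imset_inj (@perm_inj _ y^-1%g))) /tr -!imset_comp.
  congr (_ == _); apply: eq_imset => a /=.
  by rewrite -!permM conjgE -!mulgA mulgV mulg1.
apply: (@le_trans _ _ (\sum_(y in [set: 'S_n] | tr y \in fixed_sets #|D| x) psi 1%g)).
  rewrite [leRHS]big_mkcondr /=; apply: ler_sum => y _; rewrite -conjY.
  by case: ifP => [_|/negbT nY']; rewrite ?char1_ge_norm // cfun0 ?normr0.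
rewrite sumr_const -[leLHS]mulr_natr mulrCA ler_wpM2l ?char1_ge0 //.
rewrite -natrM ler_nat mulnC -sum1_card.
rewrite (partition_big tr (fun B => B \in fixed_sets #|D| x)) /=; last first.
  by move=> y /andP[].
rewrite -sum_nat_const; apply: leq_sum => B _.
rewrite sum1_card.
case: (pickP [pred y | tr y == B]) => [y0 /= /eqP B0|none]; last first.
  rewrite eq_card0 // => y; apply/negbTE; rewrite negb_and orbC.
  by have /= -> := none y.
rewrite -(card_imset _ (mulgI y0^-1%g)); apply/subset_leq_card/subsetP => z /imsetP[y].
rewrite unfold_in => /andP[_ /eqP yB] ->{z}.
suff: (y0^-1 * y)%g \in Y by []; rewrite YE.
have -> : (y0^-1 * y)%g @: D = y @: tr y0.
  by rewrite /tr -imset_comp; apply: eq_imset => a; rewrite /= permM.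
rewrite B0 -yB /tr -imset_comp; apply/eqP.
by rewrite -[RHS]imset_id; apply: eq_imset => a /=; rewrite permKV.
Qed.

Lemma coset_norm2_le_constt n (D I : {set 'I_n}) (t : 'S_n)
    (chi : 'CF([set: 'S_n])) (psi : 'CF('N(D | 'P)%G)) :
    chi \in irr [set: 'S_n] -> psi \is a character ->
    '['Res['N(D | 'P)%G] chi, psi] != 0 ->
  \sum_(h in 'C(I | 'P)%G) `|chi (h * t)%g| ^+ 2 <=
    psi 1%g ^+ 2 * (4 ^ #|I| * #|D|.+1 * #|'C(I | 'P)%G|)%:R.
Proof.
move=> /irrP[i ->] Npsi nz.
pose theta := 'Ind[[set: 'S_n]%G] psi.
have Ntheta : theta \is a character by apply: cfInd_char.
have : i \in irr_constt theta.
  by rewrite irr_consttE cfdotC conjC_eq0 /theta -cfdot_Res_l.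
case/(constt_charP _ Ntheta) => eta Neta Etheta.
apply: le_trans (@coset_norm2_le _ [set: 'S_n]%G _ (subsetT _) _ theta t (irr_char i) _ (in_setT t)) _.
  by rewrite Etheta addrC addKr.
apply: (@le_trans _ _ (\sum_(h in 'C(I | 'P)%G) psi 1%g ^+ 2 * (#|fixed_sets #|D| h| ^ 2)%:R)).
  apply: ler_sum => h _; rewrite natrX -exprMn lerXn2r ?nnegrE ?normr_ge0 //.
    by rewrite mulr_ge0 ?char1_ge0 ?ler0n.
  exact: cfInd_norm_le.
rewrite -mulr_sumr ler_wpM2l ?exprn_ge0 ?char1_ge0 // -natr_sum ler_nat.
exact: sum_fixed_sets_sqr.
Qed.

(** * Specht modules as row spaces of left multiplications *)

(** The restriction of the character of U is the sum of the character of W and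
that of the quotient U / W, and its inner product with the former is positive. *)
Lemma constt_of_submodule (gT : finGroupType) (G H : {group gT})
    (sHG : H \subset G) n (rG : mx_representation algC G n)
    (U W : 'M_n) (modU : mxmodule rG U) :
    mxmodule (subg_repr rG sHG) W -> (W <= U)%MS -> W != 0 ->
  exists2 psi : 'CF(H), psi \is a character &
    psi 1%g = (\rank W)%:R /\
    '['Res[H] (cfRepr (submod_repr modU)), psi] != 0.
Proof.
move=> modW sWU nzW.
pose rU := subg_repr (submod_repr modU) sHG.
pose V := <<in_submod U W>>%MS.
have modV : mxmodule rU V.
  rewrite /V (eqmx_module _ (genmxE _)).
  have modUH : mxmodule (subg_repr rG sHG) U.
    by apply/mxmoduleP => x Hx; apply: (mxmoduleP modU); apply: (subsetP sHG).
  have := in_submod_module modUH sWU; rewrite modW => /mxmoduleP mW.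
  by apply/mxmoduleP => x Hx; apply: mW.
pose psi := cfRepr (submod_repr modV); pose eta := cfRepr (factmod_repr modV).
have Npsi : psi \is a character by apply: cfRepr_char.
have rV : \rank V = \rank W.
  rewrite /V genmxE; apply/eqP; rewrite eqn_leq; apply/andP; split.
    by rewrite in_submodE mxrankM_maxl.
  by rewrite -{1}(in_submodK sWU) val_submodE mxrankM_maxl.
have psi1 : psi 1%g = (\rank W)%:R by rewrite cfRepr1 rV.
exists psi => //; split=> //.
have -> : 'Res[H] (cfRepr (submod_repr modU)) = psi + eta.
  rewrite -(cfRepr_sub _ sHG); apply/cfun_inP => x Hx.
  by rewrite cfunE !cfunE Hx !mulr1n -(mxtrace_sub_fact_mod modV).
rewrite cfdotDl gt_eqF // ltr_wpDr //.
  by apply/natr_ge0/Cnat_cfdot_char => //; apply: cfRepr_char.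
rewrite cfnorm_gt0; apply: contra_neq nzW => psi0.
apply/eqP; rewrite -mxrank_eq0 -(eqr_nat algC) -psi1 psi0 cfunE; exact/eqP.
Qed.

Section LeftMultiplication.
Variable n : nat.
Local Notation G := [set: 'S_n].
Local Notation N := #|[set: 'S_n]|.
Local Notation aG := (regular_repr algC [set: 'S_n]%G).
Implicit Types (c f : 'S_n -> algC) (g x : 'S_n).

Definition gring_vec f : 'rV[algC]_N := \row_j f (enum_val j).

(** Row vectors are elements x of the group algebra, and v *m left_mul_mx c is
the product of c and v in that order. *)
Definition left_mul_mx c : 'M[algC]_N :=
  \matrix_(i, j) c (enum_val j * (enum_val i)^-1)%g.

Lemma gring_vecE f x : gring_vec f 0 (gring_index [set: 'S_n]%G x) = f x.
Proof. by rewrite mxE gring_indexK ?inE. Qed.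

Lemma gring_vec_regular f g :
  gring_vec f *m aG g = gring_vec (fun x => f (x * g^-1)%g).
Proof.
apply/rowP => j; rewrite mxE [RHS]mxE.
rewrite (bigD1 (gring_index [set: 'S_n]%G (enum_val j * g^-1)%g)) //=.
rewrite gring_vecE !mxE gring_indexK ?inE // mulgKV gring_valK !eqxx mulr1.
rewrite big1 ?addr0 // => i nij; rewrite !mxE /= -(inj_eq enum_val_inj).
rewrite gring_indexK ?inE //; case: eqP => [e|]; last by rewrite mulr0.
by rewrite e mulgK gring_valK eqxx in nij.
Qed.

Lemma row_left_mul c i :
  row i (left_mul_mx c) = gring_vec c *m aG (enum_val i).
Proof. by rewrite gring_vec_regular; apply/rowP => j; rewrite !mxE. Qed.

Lemma tr_left_mul c : (left_mul_mx c)^T = left_mul_mx (fun x => c x^-1%g).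
Proof. by apply/matrixP => i j; rewrite !mxE invMg invgK. Qed.

Lemma left_mul_comm c g : left_mul_mx c *m aG g = aG g *m left_mul_mx c.
Proof.
apply/row_matrixP => i; rewrite !row_mul row_left_mul rowK -rowE row_left_mul.
by rewrite gring_indexK ?inE // repr_mxM ?inE // mulmxA.
Qed.

(** The right ideal generated by c is the image of left multiplication by c. *)
Lemma cyclic_left_mul c : (cyclic_mx aG (gring_vec c) :=: left_mul_mx c)%MS.
Proof.
apply/eqmxP/andP; split; last first.
  apply/row_subP => i; rewrite row_left_mul.
  by apply: mxmodule_trans (cyclic_mx_module _ _) _ (cyclic_mx_id _ _); rewrite inE.
apply: cyclic_mx_sub.
  by apply/mxmoduleP => g _; rewrite left_mul_comm submxMl.
have -> : gring_vec c = row (gring_index [set: 'S_n]%G 1%g) (left_mul_mx c).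
  by rewrite row_left_mul gring_indexK ?inE // repr_mx1 mulmx1.
exact: row_sub.
Qed.
End LeftMultiplication.

(** Row and column groups of a tableau treated on an equal footing: a labelling
assigns to each letter the number of its row, or of its column. *)
Definition label_stab n (lab : 'I_n -> nat) : {set 'S_n} :=
  [set s : 'S_n | [forall k, lab (s k) == lab k]].

Lemma label_stabP n (lab : 'I_n -> nat) (s : 'S_n) :
  reflect (forall k, lab (s k) = lab k) (s \in label_stab lab).
Proof. by rewrite inE; apply: (iffP forallP) => h k; apply/eqP. Qed.

Lemma label_stabM n (lab : 'I_n -> nat) (s t : 'S_n) :
  t \in label_stab lab -> ((s * t)%g \in label_stab lab) = (s \in label_stab lab).
Proof.
move/label_stabP => ht.
by apply/label_stabP/label_stabP => h k; have := h k; rewrite permM ht.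
Qed.

Lemma label_stabV n (lab : 'I_n -> nat) (s : 'S_n) :
  (s^-1%g \in label_stab lab) = (s \in label_stab lab).
Proof.
apply/label_stabP/label_stabP => h k; first by rewrite -[in RHS](permK s k) h.
by rewrite -[in RHS](permKV s k) h.
Qed.

(** The flags a and b put the sign on the first or on the second factor, so that
inversion exchanges the two sides instead of leaving this family. *)
Definition two_sided_sum n (a b : bool) (P Q : {set 'S_n}) (g : 'S_n) : algC :=
  \sum_(p in P) \sum_(q in Q)
     (-1) ^+ (a && odd_perm p) * (-1) ^+ (b && odd_perm q) * (p * q == g)%g%:R.

Lemma young_symE n lam : young_sym n lam =
  gring_vec (two_sided_sum false true (row_group n lam) (col_group n lam)).
Proof.
apply/rowP => j; rewrite summxE mxE; apply: eq_bigr => p _.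
rewrite summxE; apply: eq_bigr => q _; rewrite !mxE /= mul1r.
congr (_ * _%:R); congr nat_of_bool; apply/eqP/eqP => [->|->].
  by rewrite gring_indexK ?inE.
by rewrite gring_valK.
Qed.

(** With [tr_left_mul], this is the exchange of rows and columns. *)
Lemma two_sided_sumV n a b (row col : 'I_n -> nat) g :
  two_sided_sum a b (label_stab row) (label_stab col) g^-1%g =
  two_sided_sum b a (label_stab col) (label_stab row) g.
Proof.
rewrite /two_sided_sum exchange_big /=.
rewrite (reindex_inj invg_inj) /=; rewrite (eq_bigl (mem (label_stab col))); last first.
  by move=> q /=; rewrite label_stabV.
apply: eq_bigr => q _.
rewrite (reindex_inj invg_inj) /=; rewrite (eq_bigl (mem (label_stab row))); last first.
  by move=> p /=; rewrite label_stabV.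
apply: eq_bigr => p _.
rewrite !odd_permV [X in X * _]mulrC; congr (_ * _%:R).
by rewrite -invMg (inj_eq invg_inj).
Qed.

Lemma two_sided_sum_real n a b (P Q : {set 'S_n}) g :
  two_sided_sum a b P Q g \is Num.real.
Proof.
apply: rpred_sum => p _; apply: rpred_sum => q _.
by rewrite !rpredM ?rpredX ?rpredN ?rpred1 ?realn.
Qed.

(** * A small constituent over the stabiliser of the block *)

(** The letters of row 0 are thought of as the long row, and D is the set of the
other letters. *)
Section LargeBlock.
Variables (n : nat) (a b : bool) (row col : 'I_n -> nat).
Hypothesis rc_inj : forall x y, row x = row y -> col x = col y -> x = y.

Local Notation P := (label_stab row).
Local Notation Q := (label_stab col).
Local Notation c := (two_sided_sum a b P Q).

Definition off_block : {set 'I_n} := [set k | row k != 0%N].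
Local Notation D := off_block.
Local Notation Y := 'N(D | 'P)%G.

(** The only letters of row 0 that a column permutation can exchange with a
letter of D. *)
Definition shared_cols : {set 'I_n} :=
  [set k | (k \notin D) && [exists x in D, col x == col k]].

Definition block_part g : algC := if g \in Y then c g else 0.

Lemma mem_blockP (s : 'S_n) : reflect (forall x, (s x \in D) = (x \in D)) (s \in Y).
Proof. exact: (iffP astabsP). Qed.

Lemma row_stab_block p : p \in P -> p \in Y.
Proof. by move/label_stabP => hp; apply/mem_blockP => x; rewrite !inE hp. Qed.

Lemma off_block_row x : x \notin D -> row x = 0%N.
Proof. by rewrite inE negbK => /eqP. Qed.

(** Outside D all letters lie in row 0, so that a column permutation preserving
D cannot move them. *)
Lemma col_stab_block q : q \in Q -> q \in Y -> perm_on D q.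
Proof.
move/label_stabP => hq /mem_blockP hY; apply/subsetP => x; rewrite inE.
apply: contraR => nDx; apply/eqP/rc_inj; last exact: hq.
by rewrite (off_block_row nDx) off_block_row ?hY.
Qed.

(** Letters of row 0 lie in distinct columns, each meeting D. *)
Lemma card_shared_cols : (#|shared_cols| <= #|D|)%N.
Proof.
pose f x := odflt x [pick k | (k \notin D) && (col x == col k)].
apply: leq_trans (leq_imset_card f D); apply/subset_leq_card/subsetP => k.
rewrite inE => /andP[nDk /exists_inP[x Dx /eqP e]]; apply/imsetP; exists x => //.
rewrite /f; case: pickP => [k' /= /andP[nDk' /eqP e']|/(_ k)]; last by rewrite nDk e eqxx.
by apply: rc_inj; rewrite -?e // !off_block_row.
Qed.

Lemma two_sided_sum_neq0 g : c g != 0 -> exists2 p, p \in P & exists2 q, q \in Q & g = (p * q)%g.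
Proof.
move=> nz; case: (boolP [exists p in P, [exists q in Q, p * q == g]%g]).
  by case/exists_inP => p Pp /exists_inP[q Qq /eqP e]; exists p => //; exists q.
rewrite negb_exists_in => /forall_inP none; case/negP: nz; apply/eqP.
apply: big1 => p Pp; apply: big1 => q Qq.
have := none p Pp; rewrite negb_exists_in => /forall_inP/(_ q Qq)/negbTE->.
by rewrite mulr0.
Qed.

(** If a column permutation takes some letter out of D, it puts it in
[shared_cols], where h and g fix it: the image of D then meets that set. *)
Lemma block_of_free_image z h g : c z != 0 -> perm_on D h -> perm_on (~: shared_cols) g ->
  (z * h * g)%g @: D \subset ~: shared_cols -> z \in Y.
Proof.
move=> /two_sided_sum_neq0[p Pp [q Qq ->]] onh ong sub.
rewrite (groupMl _ (row_stab_block Pp)).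
have sq : q @: D \subset D.
  apply/subsetP => _ /imsetP[x Dx ->]; apply/negPn/negP => nD.
  have Aq : q x \in shared_cols.
    rewrite inE nD; apply/exists_inP; exists x => //.
    by rewrite (label_stabP _ _ Qq).
  pose y := p^-1%g x.
  have Dy : y \in D.
    by have /mem_blockP h0 := row_stab_block Pp; rewrite -h0 permKV.
  have /(subsetP sub) : (p * q * h * g)%g y \in (p * q * h * g)%g @: D by apply: imset_f.
  rewrite !permM permKV (out_perm onh) // (out_perm ong) in_setC Aq //.
apply/mem_blockP => x; have eqD : q @: D = D.
  by apply/eqP; rewrite eqEcard sq card_imset ?leqnn //; apply: perm_inj.
by rewrite -{1}eqD mem_imset //; apply: perm_inj.
Qed.

(** A term p q of c lies in Y only if q moves letters of D alone. Such a q
commutes with y, and y is then absorbed by the row group. *)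
Lemma block_part_first_factor y z : perm_on (~: D) y ->
  block_part (z * y^-1)%g = (-1) ^+ (a && odd_perm y) * block_part z.
Proof.
move=> ony; have Yy : y \in Y.
  apply/mem_blockP => x; have [Dx|nDx] := boolP (x \in D).
    by rewrite (out_perm ony) // in_setC Dx.
  by have e := perm_closed x ony; rewrite !in_setC in e; apply/negbTE; rewrite e.
have Py : y \in P.
  apply/label_stabP => x; have [Dx|nDx] := boolP (x \in D).
    by rewrite (out_perm ony) // in_setC Dx.
  by rewrite !off_block_row // (mem_blockP _ Yy).
rewrite /block_part groupMr ?groupV //; case: ifP => [Yz|_]; last by rewrite mulr0.
rewrite /two_sided_sum (reindex_inj (mulIg y^-1%g)) /= mulr_sumr.
rewrite (eq_bigl (mem P)); last first.
  by move=> p; rewrite /= label_stabM // label_stabV.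
apply: eq_bigr => p Pp; rewrite mulr_sumr; apply: eq_bigr => q Qq.
have [Yq|nYq] := boolP (q \in Y); last first.
  have out w : w \in Y -> (p * q == w)%g = false.
    by move=> Yw; apply: contraNF nYq => /eqP e; rewrite -(groupMl _ (row_stab_block Pp)) e.
  rewrite (out z Yz) -mulgA (_ : (p * (y^-1 * q) == z * y^-1)%g = false) ?mulr0 //.
  apply: contraNF nYq => /eqP e.
  by rewrite -(groupMl _ (groupVr Yy)) -(groupMl _ (row_stab_block Pp)) e groupMr ?groupV.
have cyq : (y^-1 * q = q * y^-1)%g.
  apply: (mulgI y); rewrite mulKVg; apply: (mulIg y); rewrite !mulgA mulgKV.
  have onq := col_stab_block Qq Yq.
  apply/permP => x; rewrite !permM; have [Dx|nDx] := boolP (x \in D).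
    rewrite [y x](out_perm ony) ?in_setC ?Dx //.
    by rewrite (out_perm ony) // in_setC perm_closed // Dx.
  rewrite [q x](out_perm onq) // (out_perm onq) //.
  by rewrite (mem_blockP _ Yy).
rewrite -mulgA cyq mulgA (inj_eq (mulIg _)) odd_permM odd_permV.
rewrite !mulrA; congr (_ * _ * _).
by case: a => /=; rewrite ?mulr1 // -signr_addb addbC.
Qed.

Local Notation N := #|[set: 'S_n]|.
Local Notation aG := (regular_repr algC [set: 'S_n]%G).
Local Notation T := (left_mul_mx c).
Local Notation rY := (subg_repr aG (subsetT Y)).

Definition block_module : 'M[algC]_N :=
  (\sum_(y in Y) <<gring_vec block_part *m aG y>>)%MS.

(** The targets to which D is carried without touching [shared_cols]. *)
Definition free_sets : {set {set 'I_n}} :=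
  [set B : {set 'I_n} | (B \subset ~: shared_cols) && (#|B| == #|D|)].

Definition restrict_mx (A : pred 'S_n) : 'M[algC]_N :=
  diag_mx (gring_vec (fun x => (A x)%:R)).

Lemma gring_vec_restrict f (A : pred 'S_n) :
  gring_vec f *m restrict_mx A = gring_vec (fun x => f x * (A x)%:R).
Proof. by apply/rowP => j; rewrite mul_mx_diag !mxE. Qed.

Lemma block_moduleP : mxmodule rY block_module.
Proof.
apply/mxmoduleP => z Yz; rewrite sumsmxMr; apply/sumsmx_subP => y Yy.
rewrite (eqmxMr _ (genmxE _)) /= -mulmxA -repr_mxM ?inE //.
by rewrite (sumsmx_sup (y * z)%g) ?groupM ?genmxE.
Qed.

Lemma block_image x y : y \in Y -> (y * x)%g @: D = x @: D.
Proof.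
move=> Yy; have eD : y @: D = D.
  apply/eqP; rewrite eqEcard card_imset ?leqnn ?andbT; last exact: perm_inj.
  by apply/subsetP => _ /imsetP[k Dk ->]; rewrite (mem_blockP _ Yy).
by rewrite -{2}eD -imset_comp; apply: eq_imset => k; rewrite /= permM.
Qed.

Lemma transport_to_free_set B : B \in free_sets ->
  exists2 g : 'S_n, perm_on (~: shared_cols) g & g @: D = B.
Proof.
rewrite inE => /andP[sB /eqP cB].
have disjD : D :&: shared_cols = set0.
  by apply/setP => x; rewrite !inE; case: (row x != 0%N).
have disjB : B :&: shared_cols = set0.
  by apply/eqP; rewrite setI_eq0 disjoints_subset.
have [|||||g ong [gD _]] := @perm_on_of_cards n shared_cols D set0 B set0 => //.
- by rewrite disjD disjB.
- by rewrite !setI0.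
by exists g.
Qed.

Definition lands_free : pred 'S_n := fun x => x @: D \in free_sets.

(** Split y into a part y1 off D, which acts on [block_part] by a sign, and a
part h on D. By [block_of_free_image], the only terms of c h g that carry D to a
free set are those of [block_part] translated by h g. *)
Lemma block_translate_sub B g y : B \in free_sets ->
    perm_on (~: shared_cols) g -> g @: D = B -> y \in Y ->
  (gring_vec block_part *m aG y *m aG g <=
     T *m restrict_mx lands_free)%MS.
Proof.
move=> FB ong gD Yy.
pose h := restr_perm D y; have onh : perm_on D h := restr_perm_on D y.
pose y1 := (y * h^-1)%g.
have ony1 : perm_on (~: D) y1.
  apply/subsetP => x; rewrite in_setC [in X in X -> _]inE; apply: contra => Dx.
  by rewrite /y1 permM -(restr_permE Yy Dx) permK.
have Yh : h \in Y.
  apply/mem_blockP => x; exact: perm_closed.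
have -> : gring_vec block_part *m aG y *m aG g = (-1) ^+ (a && odd_perm y1) *:
    (gring_vec c *m aG (h * g)%g *m restrict_mx lands_free).
  rewrite -mulmxA -repr_mxM ?inE // !gring_vec_regular gring_vec_restrict.
  apply/rowP => j; rewrite !mxE; move: (enum_val j) => x.
  have -> : y = (y1 * h)%g by rewrite /y1 mulgKV.
  rewrite -mulgA invMg mulgA (block_part_first_factor _ ony1); congr (_ * _).
  set z := (x * (h * g)^-1)%g.
  have xz : x = (z * h * g)%g by rewrite /z -!mulgA mulVg mulg1.
  case Fx: (lands_free x); rewrite ?mulr1 ?mulr0.
    rewrite /block_part; case: ifP => // nYz; apply/esym/eqP; apply: contraFT nYz => nz.
    apply: block_of_free_image nz onh ong _; rewrite -xz.
    by move: Fx; rewrite /lands_free inE => /andP[].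
  rewrite /block_part; case: ifP => // Yz; move: Fx; rewrite /lands_free xz -mulgA block_image //.
  by rewrite block_image // gD FB.
rewrite scalemx_sub // submxMr // -[(h * g)%g](@gring_indexK _ [set: 'S_n]%G) ?inE //.
by rewrite -row_left_mul row_sub.
Qed.

(** The translate that lives over B is the image of [block_module] under
a permutation carrying D to B. The translates over distinct free sets have
disjoint supports, hence are independent, and all of them lie in the restriction
of the row space of T. *)
Lemma rank_block_module : (#|free_sets| * \rank block_module <= \rank T)%N.
Proof.
pose g B : 'S_n := odflt 1%g
  [pick g : 'S_n | perm_on (~: shared_cols) g && (g @: D == B)].
have gP B : B \in free_sets -> perm_on (~: shared_cols) (g B) /\ g B @: D = B.
  move=> FB; rewrite /g; case: pickP => [s /andP[ons /eqP] //|none].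
  have [s ons sD] := transport_to_free_set FB.
  by have := none s; rewrite ons sD eqxx.
(* M B is the translate over B, and E B restricts to the permutations sending D
   to B *)
pose M B := block_module *m aG (g B).
pose E B := restrict_mx (fun x : 'S_n => x @: D == B).
pose E' := restrict_mx lands_free.
have ME B B' : B \in free_sets -> M B *m E B' = if B == B' then M B else 0.
  move=> FB; have [_ gD] := gP B FB.
  pose K := aG (g B) *m E B' - (B == B')%:R *: aG (g B).
  suff : block_module *m K = 0.
    rewrite mulmxBr mulmxA -scalemxAr => /eqP; rewrite subr_eq0 => /eqP ->.
    by case: ifP; rewrite ?scale1r ?scale0r.
  apply/eqP; rewrite -sub_kermx; apply/sumsmx_subP => y Yy.
  rewrite genmxE sub_kermx mulmxBr mulmxA -scalemxAr subr_eq0.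
  rewrite !gring_vec_regular gring_vec_restrict; apply/eqP/rowP => j.
  rewrite !mxE; move: (enum_val j) => x; rewrite mulrC.
  rewrite /block_part; case: ifP => [Yz|]; last by rewrite !mulr0.
  have -> : x @: D = B; last by [].
  by rewrite -gD -(block_image (g B) (groupM Yz Yy)) !mulgKV.
have MT B : B \in free_sets -> (M B <= T *m E' )%MS.
  move=> FB; have [ong gD] := gP B FB.
  rewrite /M sumsmxMr; apply/sumsmx_subP => y Yy.
  rewrite (eqmxMr _ (genmxE _)); exact: (block_translate_sub FB ong gD Yy).
have dirM : mxdirect (\sum_(B in free_sets) M B)%MS.
  apply/mxdirect_sumsP => B FB; apply/eqP; rewrite -submx0.
  set S := (\sum_(j | _) _)%MS.
  have SE : (S *m E B = 0)%MS.
    apply/eqP; rewrite -sub_kermx; apply/sumsmx_subP => B' /andP[FB' nB].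
    by rewrite sub_kermx ME // (negbTE nB).
  have fixM : (M B *m E B = M B)%MS by rewrite ME // eqxx.
  set X := (_ :&: _)%MS.
  have XM : X *m E B = X.
    by have /submxP[A eA] : (X <= M B)%MS by [apply: capmxSl]; rewrite eA -mulmxA fixM.
  rewrite -XM; have /submxP[A ->] : (X <= S)%MS by apply: capmxSr.
  by rewrite -mulmxA SE mulmx0 sub0mx.
have -> : (#|free_sets| * \rank block_module)%N = \rank (\sum_(B in free_sets) M B)%MS.
  rewrite (mxdirectP dirM) /= -sum_nat_const; apply: eq_bigr => B _.
  by rewrite mxrankMfree // row_free_unit repr_mx_unit ?inE.
apply: leq_trans (mxrankM_maxl T E').
by apply: mxrankS; apply/sumsmx_subP.
Qed.

Lemma card_free_sets : ('C(n - #|D|, #|D|) <= #|free_sets|)%N.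
Proof.
rewrite /free_sets cards_draws leq_bin2l // leq_subLR.
by rewrite -[leqLHS]card_ord -(cardsC shared_cols) leq_add2r card_shared_cols.
Qed.

(** Distinct letters differ in their row or in their column, so the identity is
the only permutation preserving both. *)
Lemma two_sided_sum1 : c 1%g = 1.
Proof.
have P1 : 1%g \in P by apply/label_stabP => k; rewrite perm1.
have Q1 : 1%g \in Q by apply/label_stabP => k; rewrite perm1.
have triv p : p \in P -> p \in Q -> p = 1%g.
  move=> /label_stabP hp /label_stabP hq; apply/permP => k; rewrite perm1.
  by apply: rc_inj.
rewrite /two_sided_sum (bigD1 1%g P1) /= (bigD1 1%g Q1) /= mulg1 eqxx.
rewrite odd_perm1 !andbF !mulr1 !big1 ?addr0 // => [p /andP[Pp np]|q /andP[Qq nq]].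
  apply: big1 => q Qq; case: eqP => [e|]; last by rewrite mulr0.
  have eq : p = q^-1%g by apply: (mulIg q); rewrite e mulVg.
  by case/eqP: np; apply: triv => //; rewrite eq label_stabV.
by rewrite mul1g (negbTE nq) mulr0.
Qed.

(** The coefficient at the identity is the sum of the squares of the values of
block_part, which are real, and block_part takes the value 1 at the identity. *)
Lemma block_part_tr_neq0 : gring_vec block_part *m T^T != 0.
Proof.
apply/eqP => /rowP/(_ (gring_index [set: 'S_n]%G 1%g)); rewrite [RHS]mxE mxE.
rewrite (eq_bigr (fun j => block_part (enum_val j) ^+ 2)); last first.
  move=> j _; rewrite !mxE gring_indexK ?inE // invg1 mulg1 /block_part.
  by case: ifP => _; rewrite ?mul0r ?expr0n.
have real0 x : block_part x \is Num.real.
  by rewrite /block_part; case: ifP => _; rewrite ?two_sided_sum_real ?rpred0.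
move/eqP; rewrite psumr_eq0; last by move=> j _; rewrite -realEsqr real0.
move/allP/(_ (gring_index [set: 'S_n]%G 1%g)); rewrite mem_index_enum.
by rewrite gring_indexK ?inE // /block_part group1 two_sided_sum1 expr1n oner_eq0 => /(_ isT).
Qed.

(** For a real row vector u = block_part T^T, vanishing of u T forces u u^T = 0. *)
Lemma block_part_tr_mul_neq0 : gring_vec block_part *m T^T *m T != 0.
Proof.
apply: contra_neq block_part_tr_neq0; set u := gring_vec block_part *m T^T => uT0.
have: u *m u^T = 0 by rewrite {2}/u trmx_mul trmxK mulmxA uT0 mul0mx.
move/rowP/(_ 0); rewrite [RHS]mxE mxE.
rewrite (eq_bigr (fun j => u 0 j ^+ 2)); last by move=> j _; rewrite [u^T _ _]mxE expr2.
have realu j : u 0 j \is Num.real.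
  rewrite mxE; apply: rpred_sum => k _; rewrite !mxE rpredM ?two_sided_sum_real //.
  by rewrite /block_part; case: ifP => _; rewrite ?two_sided_sum_real ?rpred0.
move/eqP; rewrite psumr_eq0; last by move=> j _; rewrite -realEsqr realu.
move/allP=> u0; apply/rowP => j; rewrite [RHS]mxE; apply/eqP.
by have := u0 j; rewrite mem_index_enum sqrf_eq0; apply.
Qed.

(** The image of [block_module] is taken under T^T T if M = T, and under T^T if
M = T^T: in both cases it lies in the row space of M and is not zero. *)
Lemma small_block_submodule (M : 'M[algC]_N) : M = T \/ M = T^T ->
  exists W : 'M[algC]_N,
    [/\ mxmodule rY W, (W <= M)%MS, W != 0 &
        ('C(n - #|D|, #|D|) * \rank W <= \rank M)%N].
Proof.
move=> MT; have rkM : \rank M = \rank T by case: MT => ->; rewrite ?mxrank_tr.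
have Tcomm : {in [set: 'S_n], forall g, T *m aG g = aG g *m T}.
  by move=> g _; apply: left_mul_comm.
have Tcomm' : {in [set: 'S_n], forall g, T^T *m aG g = aG g *m T^T}.
  by move=> g _; rewrite tr_left_mul; apply: left_mul_comm.
have main (X : 'M[algC]_N) : (forall g, X *m aG g = aG g *m X) ->
    (X <= M)%MS -> gring_vec block_part *m X != 0 ->
  exists W : 'M[algC]_N, [/\ mxmodule rY W, (W <= M)%MS, W != 0 &
        ('C(n - #|D|, #|D|) * \rank W <= \rank M)%N].
  move=> Xcomm sXM nz; exists (block_module *m X); split.
  - apply/mxmoduleP => y Yy; rewrite -mulmxA Xcomm mulmxA submxMr //.
    exact: (mxmoduleP block_moduleP).
  - by apply: submx_trans sXM; apply: submxMl.
  - apply: contraNneq nz => W0; rewrite -submx0 -W0 submxMr //.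
    by rewrite (sumsmx_sup 1%g) ?group1 // genmxE repr_mx1 mulmx1.
  - rewrite rkM; apply: leq_trans (leq_trans (leq_mul card_free_sets _) rank_block_module).
      by [].
    exact: mxrankM_maxl.
case: MT => MT; rewrite MT in main *.
  apply: (main (T^T *m T)); last by rewrite mulmxA block_part_tr_mul_neq0.
    by move=> g; rewrite -mulmxA Tcomm ?inE // mulmxA Tcomm' ?inE // mulmxA.
  exact: submxMl.
apply: (main T^T); last exact: block_part_tr_neq0.
  by move=> g; rewrite Tcomm' ?inE.
exact: submx_refl.
Qed.
End LargeBlock.

(** * Binomial bounds *)

(** Each factor (N - i) / (d - i) of the binomial coefficient is at least N / d. *)
Lemma expn_le_bin N d : (d <= N)%N -> (N ^ d <= d ^ d * 'C(N, d))%N.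
Proof.
move=> led.
have step k : (k <= d)%N -> (N ^ k * d ^_ k <= d ^ k * N ^_ k)%N.
  elim: k => [|k IHk] ltk; first by rewrite !ffactn0.
  rewrite !expnSr !ffactnSr mulnACA [leqRHS]mulnACA.
  apply: leq_mul; first by apply: IHk; apply: ltnW.
  by rewrite mulnBr mulnBr [(d * N)%N]mulnC leq_sub2l // leq_mul2r led orbT.
by have := step d (leqnn d); rewrite ffactnn -bin_ffact mulnA leq_pmul2r ?fact_gt0.
Qed.

Lemma level_bin_bound n d : (2 * d <= n)%N -> (n ^ d <= (2 * d) ^ d * 'C(n - d, d))%N.
Proof.
move=> le2d; rewrite expnMn -mulnA.
apply: leq_trans (leq_mul (leqnn _) (expn_le_bin (_ : d <= n - d)%N)); last by lia.
rewrite -expnMn; case: d le2d => // d le2d; rewrite leq_exp2r //; lia.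
Qed.

(** * Specht characters *)

(** Conjugating the matrix of x in a basis of U gives its matrix in the conjugate
basis, which spans the same space: the two matrices are similar. *)
Lemma submod_char_real (gT : finGroupType) (G : {group gT}) n
    (rG : mx_representation algC G n) (U : 'M_n) (modU : mxmodule rG U) x :
    (forall g, map_mx Num.conj (rG g) = rG g) -> (map_mx Num.conj U :=: U)%MS ->
  cfRepr (submod_repr modU) x \is Num.real.
Proof.
move=> realG realU; rewrite cfunE; case: (boolP (x \in G)) => Gx; last first.
  by rewrite mulr0n.
rewrite mulr1n; set M := submod_repr modU x.
pose B := val_submod (1%:M : 'M_(\rank U)).
have defM : M *m B = B *m rG x.
  by rewrite /B -val_submodE -[M]mul1mx val_submodJ.
have freeB : row_free B by rewrite -row_leq_rank /B val_submod1.
have /submxP[X defX] : (map_mx Num.conj B <= B)%MS.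
  by rewrite val_submod1 -realU map_submx val_submod1.
clearbody M B.
have unitX : X \in unitmx.
  rewrite -row_free_unit -row_leq_rank -(mxrankMfree X freeB) -defX mxrank_map.
  by rewrite row_leq_rank.
have intertwine : map_mx Num.conj M *m X = X *m M.
  suff : map_mx Num.conj M *m X *m B = X *m M *m B by move/(row_free_inj freeB).
  rewrite -!mulmxA defM -defX -map_mxM defM.
  by rewrite map_mxM realG defX -mulmxA.
apply/CrealP; rewrite -trace_map_mx.
by rewrite -[map_mx _ M](mulmxK unitX) intertwine mxtrace_mulC mulmxA mulVmx ?mul1mx.
Qed.

Lemma card_first_row n lam : sumn lam = n ->
  #|off_block (fun k : 'I_n => reshape_index lam k)| = (n - head 0%N lam)%N.
Proof.
case: lam => [|a l] /=.
  by move=> <-; apply/eqP; rewrite cards_eq0; apply/eqP/setP => -[].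
move=> sl; have lean : (a <= n)%N by rewrite -sl leq_addr.
have -> : off_block (fun k : 'I_n => reshape_index (a :: l) k) = ~: [set widen_ord lean i | i : 'I_a].
  apply/setP => k; rewrite !inE /reshape_index /=.
  rewrite subn_eq0; case: ltnP => [lt|ge]; apply/esym.
    by apply/negbTE; rewrite negbK; apply/imsetP; exists (Ordinal lt) => //; apply: val_inj.
  by apply: contraL ge => /imsetP[i _ ->] /=; rewrite -ltnNge.
by rewrite cardsCs setCK card_imset ?card_ord // => i j [] /val_inj.
Qed.

(** The letters in column 0 are the first letters of the rows, so there is one
for each part of lam. *)
Lemma card_first_col n lam : is_partition n lam ->
  #|off_block (fun k : 'I_n => reshape_offset lam k)| = (n - head 0%N (conj_part lam))%N.
Proof.
case/and3P=> _ pos /eqP sl.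
have -> : head 0%N (conj_part lam) = size lam.
  case: lam pos {sl} => //= a l; rewrite inE negb_or => /andP[a0 l0].
  rewrite /conj_part /=; case: a a0 => // a _ /=.
  rewrite add1n; congr _.+1; apply/eqP; rewrite -all_count; apply/allP => x lx.
  by rewrite lt0n; apply: contraNneq l0 => <-.
have pos_nth r : (r < size lam)%N -> (0 < nth 0 lam r)%N.
  by move=> lt; rewrite lt0n; apply: contraNneq pos => <-; apply: mem_nth.
have lt_n (r : 'I_(size lam)) : (flatten_index lam r 0 < n)%N.
  by rewrite -sl flatten_indexP // pos_nth.
pose f r := Ordinal (lt_n r).
have f_inj : injective f.
  move=> r s /(congr1 (fun k : 'I_n => reshape_index lam k)) /=.
  by rewrite !flatten_indexKl ?pos_nth // => /val_inj.
rewrite cardsCs card_ord -[in RHS](card_ord (size lam)) -cardsT -(card_imset _ f_inj).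
congr (_ - _)%N; congr #|pred_of_set _|; apply/setP => k; rewrite !inE negbK.
apply/eqP/imsetP => [k0|[r _ ->]]; last by rewrite flatten_indexKr ?pos_nth.
have ltk : (reshape_index lam k < size lam)%N by rewrite reshape_indexP ?sl.
by exists (Ordinal ltk) => //; apply: val_inj; rewrite /= -k0 reshape_indexK.
Qed.

(** The set D consists of the letters outside the first row if n - lam_1 realises
the level, and outside the first column otherwise. *)
Lemma specht_small_constituent n lam : is_partition n lam ->
  exists D : {set 'I_n}, #|D| = part_level n lam /\
  exists2 psi : 'CF('N(D | 'P)%G), psi \is a character &
    '['Res['N(D | 'P)%G] (specht_char n lam), psi] != 0 /\
    'C(n - #|D|, #|D|)%:R * psi 1%g <= specht_char n lam 1%g.
Proof.
move=> part; have sl : sumn lam = n by case/and3P: part => _ _ /eqP.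
pose row (k : 'I_n) := reshape_index lam k.
pose col (k : 'I_n) := reshape_offset lam k.
have rc x y : row x = row y -> col x = col y -> x = y.
  move=> er ec; apply: val_inj => /=.
  by rewrite -(reshape_indexK lam x) -[RHS](reshape_indexK lam y) -/(row x) er -/(col x) ec.
have cr x y : col x = col y -> row x = row y -> x = y by move=> ec er; apply: rc.
pose T := left_mul_mx (two_sided_sum false true (label_stab row) (label_stab col)).
have UT : (cyclic_mx (regular_repr algC [set: 'S_n]%G) (young_sym n lam) :=: T)%MS.
  by rewrite young_symE; apply: cyclic_left_mul.
have finish (D : {set 'I_n}) (W : 'M[algC]_#|[set: 'S_n]|) :
    mxmodule (subg_repr (regular_repr algC [set: 'S_n]%G) (subsetT 'N(D | 'P)%G)) W ->
    (W <= T)%MS -> W != 0 -> ('C(n - #|D|, #|D|) * \rank W <= \rank T)%N ->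
  exists2 psi : 'CF('N(D | 'P)%G), psi \is a character &
    '['Res['N(D | 'P)%G] (specht_char n lam), psi] != 0 /\
    'C(n - #|D|, #|D|)%:R * psi 1%g <= specht_char n lam 1%g.
  move=> modW sWT nzW rkW; rewrite -UT in sWT.
  have [psi Npsi [psi1 nz]] := constt_of_submodule
    (cyclic_mx_module (regular_repr algC [set: 'S_n]%G) (young_sym n lam)) modW sWT nzW.
  exists psi => //; split=> //.
  by rewrite psi1 /specht_char cfRepr1 -natrM ler_nat UT.
rewrite /part_level; case: leqP => _.
  exists (off_block row); split; first exact: card_first_row.
  have [W [modW sW nzW rkW]] := @small_block_submodule n false true row col rc T (or_introl erefl).
  exact: finish modW sW nzW rkW.
exists (off_block col); split; first exact: card_first_col.
have trT : T = (left_mul_mx (two_sided_sum true false (label_stab col) (label_stab row)))^T.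
  by rewrite tr_left_mul; apply/matrixP => i j; rewrite !mxE two_sided_sumV.
have [W [modW sW nzW rkW]] := @small_block_submodule n true false col row cr T (or_intror trT).
exact: finish modW sW nzW rkW.
Qed.

(** The Young symmetrizer has rational coefficients. *)
Lemma specht_char_real n lam x : specht_char n lam x \is Num.real.
Proof.
pose T := left_mul_mx (two_sided_sum false true (row_group n lam) (col_group n lam)).
have UT : (cyclic_mx (regular_repr algC [set: 'S_n]%G) (young_sym n lam) :=: T)%MS.
  by rewrite young_symE; apply: cyclic_left_mul.
apply: submod_char_real => [g|]; first exact: map_regular_mx.
have realT : map_mx Num.conj T = T.
  by apply/matrixP => i j; rewrite !mxE; apply/CrealP/two_sided_sum_real.
apply/eqmxP/andP; split.
  by rewrite UT -[X in (_ <= X)%MS]realT map_submx UT.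
by rewrite UT -[X in (X <= _)%MS]realT map_submx UT.
Qed.

(** * Globalness *)

Lemma sum_umvirate n m (I J : m.-tuple 'I_n) t (F : 'S_n -> algC) :
    t \in umvirate I J ->
  \sum_(s in umvirate I J) F s =
    \sum_(h in 'C([set x in I] | 'P)%G) F (h * t)%g.
Proof.
rewrite inE => /forallP tIJ; rewrite (reindex_inj (mulIg t)) /=.
apply: eq_bigl => h; rewrite inE; apply/forallP/astabP => [hI x|hI k].
  rewrite inE => /tnthP[k ->]; apply: (@perm_inj _ t).
  by have := hI k; rewrite permM (eqP (tIJ k)) => /eqP.
by rewrite permM [h _](hI (tnth I k)) ?inE ?mem_tnth.
Qed.

Lemma card_pointwise_stab n m (I : m.-tuple 'I_n) : uniq I ->
  #|'C([set x in I] | 'P)%G| = ((n - m)`!)%N.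
Proof.
move=> uI; have cI : #|[set x in I]| = m by rewrite cardsE (card_uniqP uI) size_tuple.
have -> : (n - m)%N = #|~: [set x in I]|.
  by rewrite cardsCs setCK card_ord cI.
rewrite -card_perm; apply: eq_card => s; apply/astabP/subsetP => [sI x|sI x Ix].
  by rewrite in_setC => nx; apply: contra nx => Ix; apply/eqP; apply: (sI x Ix).
apply/eqP/negPn/negP => nx.
by have := sI x nx; rewrite in_setC Ix.
Qed.

Lemma norm2_restr_le n m (I J : m.-tuple 'I_n) (chi : 'CF([set: 'S_n])) (y : algC) :
    uniq I -> (forall s, chi s \is Num.real) -> 0 <= y ->
    (forall t, \sum_(h in 'C([set x in I] | 'P)%G) `|chi (h * t)%g| ^+ 2 <=
       y ^+ 2 * #|'C([set x in I] | 'P)%G|%:R) ->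
  norm2_restr chi I J <= y.
Proof.
move=> uI real_chi y0 bound; rewrite /norm2_restr.
have f0 : (0 : algC) < ((n - m)`!)%:R by rewrite ltr0n fact_gt0.
have sq s : chi s ^+ 2 = `|chi s| ^+ 2 by rewrite real_normK.
have [U0|[t Ut]] := set_0Vmem (umvirate I J).
  by rewrite U0 big_set0 mulr0 sqrtC0.
have S0 : 0 <= \sum_(s in umvirate I J) chi s ^+ 2.
  by apply: sumr_ge0 => s _; rewrite sq exprn_ge0.
rewrite -(sqrCK y0) ler_sqrtC ?nnegrE ?exprn_ge0 ?mulr_ge0 ?invr_ge0 ?ler0n //.
rewrite ler_pdivrMl // (sum_umvirate _ Ut) mulrC -(card_pointwise_stab uI).
by apply: le_trans (bound t); apply: ler_sum => h _; rewrite sq.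
Qed.

Theorem proposition1p15 :
  exists C : algC, 0 < C /\
    forall (n d : nat) (chi : 'CF([set: 'S_n])),
      (0 < d)%N -> chi \in irr [set: 'S_n] -> has_level chi d ->
      is_global 2 ((C * d%:R / n%:R) ^+ d * chi 1%g) chi.
Proof.
exists 4; split; first by rewrite ltr0n.
move=> n d chi d0 irr_chi [lam [part chiE level]].
have real_chi s : chi s \is Num.real by rewrite chiE specht_char_real.
have Nchi : chi \is a character by case/irrP: irr_chi => i ->; apply: irr_char.
split=> // m I J uI uJ; set H := 'C([set x in I] | 'P)%G.
have chi1 : 0 <= chi 1%g by apply: char1_ge0.
have n0 : (0 < n)%N.
  by apply: leq_trans d0 _; rewrite -level; apply: leq_trans (geq_minl _ _) (leq_subr _ _).
have nR : (0 : algC) < n%:R by rewrite ltr0n.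
have q0 : 0 <= 4 * d%:R / n%:R :> algC by rewrite divr_ge0 ?mulr_ge0 ?ler0n.
apply: norm2_restr_le => // [|t]; first by rewrite !mulr_ge0 ?exprn_ge0 ?ler0n.
(* for n < 2d the bound exceeds chi 1 already *)
have [big_d|small_d] := ltnP n (2 * d).
  have q1 : 1 <= 4 * d%:R / n%:R :> algC.
    by rewrite ler_pdivlMr // mul1r -natrM ler_nat; lia.
  apply: (@le_trans _ _ (\sum_(h in H) chi 1%g ^+ 2)).
    apply: ler_sum => h _; rewrite lerXn2r ?nnegrE ?normr_ge0 //.
    exact: char1_ge_norm.
  rewrite sumr_const -[leLHS]mulr_natr ler_wpM2r ?ler0n // lerXn2r ?nnegrE //.
    by rewrite !mulr_ge0 ?exprn_ge0 ?ler0n.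
  by rewrite mulrA ler_peMl // mulr_ege1 ?exprn_ege1 // ler1n.
have [D [cD [psi Npsi [nz psi_le]]]] := specht_small_constituent part.
rewrite -chiE level in cD nz psi_le.
apply: le_trans (coset_norm2_le_constt _ _ irr_chi Npsi nz) _.
have cI : #|[set x in I]| = m by rewrite cardsE (card_uniqP uI) size_tuple.
rewrite natrM mulrA ler_wpM2r ?ler0n // cI cD.
have psi0 : 0 <= psi 1%g by apply: char1_ge0.
have npsi : n%:R ^+ d * psi 1%g <= (2 * d%:R) ^+ d * chi 1%g.
  apply: (@le_trans _ _ ((2 * d%:R) ^+ d * ('C(n - d, d)%:R * psi 1%g))).
    rewrite mulrA ler_wpM2r // -natrM -!natrX -natrM ler_nat.
    exact: level_bin_bound.
  by rewrite ler_wpM2l ?exprn_ge0 ?mulr_ge0 ?ler0n // -cD.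
(* 4 = 2 * 2: one factor 2 pays for d + 1 <= 4 ^ d, the other is the 2 of
   [level_bin_bound] *)
have -> : 2 ^+ m * ((4 * d%:R / n%:R) ^+ d * chi 1%g) =
    2 ^+ m * 2 ^+ d * ((2 * d%:R) ^+ d * chi 1%g / n%:R ^+ d) :> algC.
  have -> : (4 : algC) = 2 * 2 by rewrite -natrM.
  by rewrite !exprMn exprVn; ring.
apply: (@le_trans _ _ ((2 ^+ m * 2 ^+ d * psi 1%g) ^+ 2)).
  rewrite exprMn mulrC ler_wpM2r ?exprn_ge0 //.
  rewrite -!natrX -natrM -natrX ler_nat expnMn -!expnM ![(_ * 2)%N]mulnC !expnM.
  by rewrite leq_mul2l ltn_expl ?orbT.
have k0 : 0 <= 2 ^+ m * 2 ^+ d :> algC by rewrite mulr_ge0 ?exprn_ge0 ?ler0n.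
have t0 : 0 <= (2 * d%:R) ^+ d * chi 1%g / n%:R ^+ d.
  by rewrite divr_ge0 ?exprn_ge0 ?ler0n // mulr_ge0 // exprn_ge0 // mulr_ge0 ?ler0n.
rewrite lerXn2r ?nnegrE ?(mulr_ge0 k0) // ler_wpM2l //.
by rewrite ler_pdivlMr ?exprn_gt0 // mulrC.
Qed.
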